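(* Let $n\ge 2$ be an integer and let $A\subseteq\mathbb{F}_{2^{n-1}}\setminus\{0\}$ with $|A|=k$ and $r(A)>0$. Then there exists a subset of $\mathbb{F}_{2^n}\setminus\{0\}$ of size $k+4$ whose $r$-value is $r(A)+36$.
   Context: For a subset $X$ of a finite additive abelian group, the $r$-value $r(X)$ is the number of ordered pairs $(x,y)\in X\times X$ with $x+y\in X$. Only the additive group of $\mathbb{F}_{2^n}$ is used: its elements are written as vectors $[\alpha_1,\dots,\alpha_n]$ with $\alpha_i\in\{0,1\}$ and addition coordinatewise modulo 2. By convention $\mathbb{F}_{2^{n-1}}$ is regarded as the subset of $\mathbb{F}_{2^n}$ consisting of the vectors with first coordinate $\alpha_1=0$. *)

(* Defs.v *)
From HB Require Import structures.
From mathcomp Require Import all_boot all_order all_algebra.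

Set Implicit Arguments.
Unset Strict Implicit.
Unset Printing Implicit Defensive.

Import GRing.Theory.
Local Open Scope ring_scope.

Definition rvalue (G : finZmodType) (X : {set G}) : nat :=
  #|[set p : G * G | [&& p.1 \in X, p.2 \in X & p.1 + p.2 \in X]]|.

(* The additive group of the field with 2 ^ n elements, in coordinates. *)
Definition F2n (n : nat) : finZmodType := 'rV['F_2]_n.

(* The copy of F2n n.-1 inside F2n n. Coordinates are indexed from 0, so index 0
   is the first one; the quantifier spares a proof of 0 < n (for n = 0 the
   condition is void). *)
Definition F2n_pred (n : nat) : {set F2n n} :=
  [set v : 'rV['F_2]_n | [forall i : 'I_n, (val i == 0%N) ==> (v 0 i == 0)]].

(* Main.v *)
Require Import Defs.
From HB Require Import structures.
From mathcomp Require Import all_boot all_order all_algebra.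

Set Implicit Arguments.
Unset Strict Implicit.
Unset Printing Implicit Defensive.

Import GRing.Theory.
Local Open Scope ring_scope.

(** Since [0 < rvalue A], some [x], [y] and [x + y] all lie in [A], and as [0]
is not in [A] the set [V = {0, x, y, x + y}] is a subgroup of order 4 with
[V :&: A = V :\ 0].  Take [v] outside the hyperplane [H] that contains [A] and
put [B = A :|: (v + V)].  Modulo [H] an equation [a + b = c] in [B] involves
either no element of the coset [v + V] or exactly two of them.  The first kind
gives the [rvalue A] old pairs.  In the second kind the two elements of the
coset differ by an element of [V :&: A], and conversely an element of the coset
together with an element of [V :&: A] determines such an equation once the
position of the element of [A] among [a], [b], [c] is chosen.  This gives
[3 * #|V| * #|A :&: V| = 3 * 4 * 3 = 36] new pairs ([rvalue_setU_translate]). *)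

Lemma rvalueE (G : finZmodType) (X : {set G}) :
  rvalue X = (\sum_(a in X) \sum_(b in X) (a + b \in X)%R)%N.
Proof.
rewrite /rvalue -sum1_card pair_big /= big_mkcond [RHS]big_mkcond /=.
apply: eq_bigr => -[a b] _; rewrite inE /=.
by case: (a \in X) (b \in X) (_ \in X) => [] [] [].
Qed.

Section ElementaryAbelian.

Variable G : finZmodType.
Hypothesis addvv : forall z : G, z + z = 0.

Let oppv (z : G) : - z = z.
Proof. by apply/eqP; rewrite eq_sym -addr_eq0 addvv. Qed.

Let addvK (a b : G) : a + (a + b) = b.
Proof. by rewrite addrA addvv add0r. Qed.

Let mem_addl (K : {set G}) a b : zmod_closed K -> a \in K ->
  (a + b \in K) = (b \in K).
Proof.
case=> _ subK aK; apply/idP/idP => h.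
  by rewrite -(addvK a b) -[X in a + X]oppv; apply: subK.
by rewrite -[b]oppv; apply: subK.
Qed.

Definition translate (v : G) (V : {set G}) := [set v + w | w in V].

Lemma card_translate (v : G) (V : {set G}) : #|translate v V| = #|V|.
Proof. by apply: card_imset; apply: addrI. Qed.

Section TranslateOfSubgroup.

Variables (H V : {set G}) (v : G).
Hypotheses (subgH : zmod_closed H) (subgV : zmod_closed V).
Hypotheses (sVH : V \subset H) (vH : v \notin H).

Let C := translate v V.

Let addH a b : a \in H -> (a + b \in H) = (b \in H) := mem_addl b subgH.
Let addV a b : a \in V -> (a + b \in V) = (b \in V) := mem_addl b subgV.

Let mem_translate c : (c \in C) = (v + c \in V).
Proof.
apply/imsetP/idP => [[w wV ->]|h]; first by rewrite addvK.
by exists (v + c); rewrite // addvK.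
Qed.

Lemma translate_notin c : c \in C -> c \notin H.
Proof.
case/imsetP => w /(subsetP sVH) wH ->.
by rewrite addrC addH.
Qed.

Lemma disjoint_translate (A : {set G}) : A \subset H -> [disjoint A & C].
Proof.
move=> /subsetP sAH; apply/pred0P => a /=; apply/negP => /andP[aA aC].
by have := translate_notin aC; rewrite sAH.
Qed.

Let add_translate c a : c \in C -> (c + a \in C) = (a \in V).
Proof. by rewrite !mem_translate addrA => cV; rewrite addV. Qed.

(** In characteristic 2 each of the three elements of an equation [a + b = c]
is the sum of the two others, so choosing which of the three lies in [A] does
not change the number of solutions; this is the factor 3. *)
Lemma rvalue_setU_translate (A : {set G}) : A \subset H ->
  rvalue (A :|: C) = (rvalue A + 3 * (#|V| * #|A :&: V|))%N.
Proof.
move=> sAH; have dAC := disjoint_translate sAH; move/subsetP: sAH => sAH.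
have addCH c a : c \in C -> a \in A -> (c + a \in A) = false.
  move=> cC aA; apply/negP => /sAH; rewrite addrC (addH _ (sAH _ aA)).
  exact/negP/translate_notin.
have sum_AV c : c \in C -> (\sum_(a in A) (c + a \in C)%R)%N = #|A :&: V|.
  move=> cC; rewrite -sum1_card big_mkcond [RHS]big_mkcond.
  apply: eq_bigr => a _; rewrite add_translate // inE.
  by case: (a \in A) (a \in V) => [] [].
have CA : (\sum_(c in C) \sum_(a in A) (c + a \in C)%R = #|V| * #|A :&: V|)%N.
  by rewrite (eq_bigr _ sum_AV) sum_nat_const card_translate.
have CC : (\sum_(c in C) \sum_(b in C) (c + b \in A)%R = #|V| * #|A :&: V|)%N.
  rewrite -CA; apply: eq_bigr => c cC.
  (* b := c + a exchanges the solutions of c + a = b and of c + b = a. *)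
  rewrite (reindex_inj (addrI c)) /= big_mkcond [RHS]big_mkcond.
  by apply: eq_bigr => a _; rewrite addvK; case: (a \in A) (_ \in C) => [] [].
have AC : (\sum_(a in A) \sum_(c in C) (a + c \in C)%R = #|V| * #|A :&: V|)%N.
  rewrite exchange_big /= -CA; apply: eq_bigr => c _.
  by apply: eq_bigr => a _; rewrite addrC.
have split F : (\sum_(a in A :|: C) F a
                = \sum_(a in A) F a + \sum_(a in C) F a)%N.
  by rewrite -bigU //; apply: eq_bigl => a; rewrite !inE.
rewrite !rvalueE split.
have -> : (\sum_(a in A) \sum_(b in A :|: C) (a + b \in A :|: C)%R
   = \sum_(a in A) \sum_(b in A) (a + b \in A)%R + #|V| * #|A :&: V|)%N.
  rewrite -AC -big_split; apply: eq_bigr => a aA; rewrite split.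
  congr (_ + _)%N; apply: eq_bigr => b bX; rewrite inE.
    suff -> : (a + b \in C) = false by rewrite orbF.
    by apply/negP => /translate_notin; rewrite addH sAH.
  by rewrite addrC addCH.
have -> : (\sum_(c in C) \sum_(b in A :|: C) (c + b \in A :|: C)%R
   = #|V| * #|A :&: V| + #|V| * #|A :&: V|)%N.
  rewrite -{1}CA -CC -big_split; apply: eq_bigr => c cC; rewrite split.
  congr (_ + _)%N; apply: eq_bigr => b bX; rewrite inE; first by rewrite addCH.
  suff -> : (c + b \in C) = false by rewrite orbF.
  rewrite add_translate //; apply/negP => /(subsetP sVH) bH.
  by have := translate_notin bX; rewrite bH.
by rewrite -addnA !mulSn mul0n addn0.
Qed.

End TranslateOfSubgroup.

Definition klein (x y : G) : {set G} := [set 0; x; y; x + y].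

Lemma klein_zmod_closed x y : zmod_closed (klein x y).
Proof.
split=> [|a b]; first by rewrite !inE eqxx.
have yx : y + x = x + y by rewrite addrC.
have xyx : x + y + x = y by rewrite addrC addvK.
have xyy : x + y + y = x by rewrite -addrA addvv addr0.
have yxy : y + (x + y) = x by rewrite addrC.
rewrite !inE -!orbA oppv.
by case/or4P=> /eqP -> /or4P[] /eqP ->;
   rewrite ?add0r ?addr0 ?addvv ?addvK ?yx ?xyx ?xyy ?yxy eqxx ?orbT.
Qed.

Lemma card_klein x y : x != 0 -> y != 0 -> x + y != 0 -> #|klein x y| = 4.
Proof.
move=> x0 y0 xy0; rewrite /klein -!setUA !cardsU1 cards1 !inE.
have xy : x != y by rewrite -[y]oppv -addr_eq0.
rewrite ![0 == _]eq_sym (negPf x0) (negPf y0) (negPf xy0) (negPf xy).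
rewrite -[X in X == x + y]addr0 (inj_eq (addrI x)) eq_sym (negPf y0).
by rewrite -[X in X == x + y]add0r (inj_eq (addIr y)) eq_sym (negPf x0).
Qed.

Lemma setI_klein (A : {set G}) x y : 0 \notin A -> x \in A -> y \in A ->
  x + y \in A -> A :&: klein x y = klein x y :\ 0.
Proof.
move=> A0 xA yA xyA; apply/setP => a; rewrite !inE -!orbA.
have [->|_] := eqVneq a 0; first by rewrite (negPf A0).
by rewrite /=; apply: andb_idl => /or3P[] /eqP ->.
Qed.

(** For a subgroup [V] of order 4 meeting [A] in its three nonzero elements, the
increment in [rvalue_setU_translate] is [3 * (4 * 3)]; a pair counted by [rvalue A]
spans such a [V]. *)
Lemma exists_rvalue_add36 (H A : {set G}) (v : G) :
    zmod_closed H -> v \notin H -> A \subset H :\ 0 -> (0 < rvalue A)%N ->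
  exists B : {set G},
    [/\ 0 \notin B, #|B| = (#|A| + 4)%N & rvalue B = (rvalue A + 36)%N].
Proof.
move=> subgH vH; rewrite subsetD1 => /andP[sAH A0].
case/card_gt0P => -[x y]; rewrite inE /= => /and3P[xA yA xyA].
have nz z : z \in A -> z != 0 by move=> zA; apply: contraNneq A0 => <-.
have cV := card_klein (nz _ xA) (nz _ yA) (nz _ xyA).
have [H0 _] := subgH.
have sVH : klein x y \subset H.
  apply/subsetP => z; rewrite !inE -!orbA.
  by case/or4P => /eqP -> //; apply: (subsetP sAH).
have V0 : 0 \in klein x y by rewrite !inE eqxx.
have subgV := klein_zmod_closed x y.
exists (A :|: translate v (klein x y)); split.
- rewrite inE (negPf A0) /=; apply/negP.
  by move=> /(translate_notin subgH sVH vH); rewrite H0.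
- have dA := disjoint_translate subgH sVH vH sAH.
  by rewrite cardsU (disjoint_setI0 dA) cards0 subn0 card_translate cV.
rewrite (rvalue_setU_translate subgH subgV sVH vH sAH) setI_klein // cV.
by move: cV; rewrite (cardsD1 0) V0 add1n => -[->].
Qed.

End ElementaryAbelian.

Lemma F2n_addvv n (z : F2n n) : z + z = 0.
Proof. by apply/rowP => i; rewrite !mxE addrr_pchar2 // pchar_Fp. Qed.

Lemma F2n_predP n (z : F2n n.+1) : (z \in F2n_pred n.+1) = (z 0 0 == 0).
Proof.
rewrite inE; apply/forallP/idP => [/(_ 0)/implyP-> // | z0 i].
by apply/implyP => /eqP i0; have -> : i = 0 by apply: val_inj.
Qed.

Lemma F2n_pred_zmod_closed n : zmod_closed (F2n_pred n.+1).
Proof.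
split=> [|a b]; rewrite !F2n_predP !mxE // => /eqP -> /eqP ->.
by rewrite subr0.
Qed.

Theorem proposition4p9 (n : nat) (hn : (2 <= n)%N) (k : nat) (A : {set F2n n})
    (hA : A \subset F2n_pred n :\ 0) (hk : #|A| = k) (hr : (0 < rvalue A)%N) :
  exists B : {set F2n n},
    [/\ B \subset [set: F2n n] :\ 0, #|B| = (k + 4)%N
      & rvalue B = (rvalue A + 36)%N].
Proof.
case: n hn A hA hk hr => // n _ A hA <- hr.
have vH : (const_mx 1 : F2n n.+1) \notin F2n_pred n.+1.
  by rewrite F2n_predP mxE oner_eq0.
have [B [B0 cB rB]] :=
  exists_rvalue_add36 (@F2n_addvv _) (@F2n_pred_zmod_closed n) vH hA hr.
by exists B; split=> //; rewrite subsetD1 subsetT.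
Qed.
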